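(* Let $K\in\mathbb{N}$ and let $\gamma\in\mathcal{D}(\mathbf{2}\times\mathbf{2})$, with marginals $\gamma_1=\mathcal{D}(\pi_1)(\gamma)$ and $\gamma_2=\mathcal{D}(\pi_2)(\gamma)$ in $\mathcal{D}(\mathbf{2})$. Then: 1. The marginals of the bivariate binomial distribution are the ordinary binomials of the marginals of $\gamma$: $$\mathcal{D}(\Pi_1)\big(\mathrm{bvbn}[K](\gamma)\big)=\mathrm{bn}[K]\big(\gamma_1(1)\big),\qquad \mathcal{D}(\Pi_2)\big(\mathrm{bvbn}[K](\gamma)\big)=\mathrm{bn}[K]\big(\gamma_2(1)\big).$$ 2. When $\gamma$ is non-entwined, that is, when $\gamma=\gamma_1\otimes\gamma_2$, then $\mathrm{bvbn}[K](\gamma)$ is also non-entwined, with $$\mathrm{bvbn}[K](\gamma_1\otimes\gamma_2)=\mathrm{bn}[K]\big(\gamma_1(1)\big)\otimes\mathrm{bn}[K]\big(\gamma_2(1)\big).$$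
   Context: $\mathbf{2}=\{0,1\}$. For a set $X$, $\mathcal{D}(X)$ is the set of finitely supported probability distributions on $X$, i.e. functions $\omega\colon X\to[0,1]$ with finite support and $\sum_x\omega(x)=1$. For $f\colon X\to Y$, $\mathcal{D}(f)\colon\mathcal{D}(X)\to\mathcal{D}(Y)$ is the pushforward $\mathcal{D}(f)(\omega)(y)=\sum_{x\in f^{-1}(y)}\omega(x)$. For $\omega\in\mathcal{D}(X)$, $\rho\in\mathcal{D}(Y)$, the product $\omega\otimes\rho\in\mathcal{D}(X\times Y)$ is $(\omega\otimes\rho)(x,y)=\omega(x)\rho(y)$. A distribution on a product set is called non-entwined if it equals the product $\otimes$ of its two marginals. The projections are $\pi_1,\pi_2\colon\mathbf{2}\times\mathbf{2}\to\mathbf{2}$ and $\Pi_1,\Pi_2\colon\{0,\ldots,K\}\times\{0,\ldots,K\}\to\{0,\ldots,K\}$. $\mathcal{M}[K](X)$ is the set of multisets over $X$ of size $K$, i.e. finitely supported functions $\varphi\colon X\to\mathbb{N}$ with $\|\varphi\|=\sum_x\varphi(x)=K$. For $\omega\in\mathcal{D}(X)$ with $X$ finite, the multinomial distribution $\mathrm{mn}[K](\omega)\in\mathcal{D}(\mathcal{M}[K](X))$ is $$\mathrm{mn}[K](\omega)(\varphi)=\frac{K!}{\prod_x\varphi(x)!}\prod_{x\in X}\omega(x)^{\varphi(x)}\qquad(0^0=1).$$ For $r\in[0,1]$, the binomial distribution $\mathrm{bn}[K](r)\in\mathcal{D}(\{0,\ldots,K\})$ is $\mathrm{bn}[K](r)(n)=\binom{K}{n}r^n(1-r)^{K-n}$.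 The marginal heads function $\mathrm{heads}\colon\mathcal{M}[K](\mathbf{2}\times\mathbf{2})\to\{0,\ldots,K\}\times\{0,\ldots,K\}$ is $\mathrm{heads}(\varphi)=\big(\varphi(1,0)+\varphi(1,1),\ \varphi(0,1)+\varphi(1,1)\big)$. The bivariate binomial distribution of $\gamma\in\mathcal{D}(\mathbf{2}\times\mathbf{2})$ with $K$ tosses is $$\mathrm{bvbn}[K](\gamma)=\mathcal{D}(\mathrm{heads})\big(\mathrm{mn}[K](\gamma)\big)\in\mathcal{D}\big(\{0,\ldots,K\}\times\{0,\ldots,K\}\big).$$ *)

(* Defs.v *)
From HB Require Import structures.
From mathcomp Require Import all_boot all_order all_algebra.
From mathcomp Require Import finmap multiset.
From mathcomp Require Import boolp classical_sets functions cardinality fsbigop.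
From mathcomp Require Import reals.
From mathcomp Require Import ring.

Set Implicit Arguments.
Unset Strict Implicit.
Unset Printing Implicit Defensive.

Import Order.TTheory GRing.Theory Num.Theory.

Local Open Scope classical_set_scope.
Local Open Scope ring_scope.

(* D(X). The \sum_(x \in A) of fsbigop is the sum of the finitely many nonzero
   terms (and 0 by convention if infinitely many terms are nonzero). *)
Record distr (R : realType) (X : choiceType) := Distr {
  dfun :> X -> R;
  distr_itv : forall x, 0 <= dfun x <= 1;
  distr_finite : finite_set [set x | dfun x != 0];
  distr_sum : \sum_(x \in [set: X]) dfun x = 1
}.

Section distr_theory.
Variable R : realType.

Lemma distr_ext (X : choiceType) (w w' : distr R X) : w =1 w' -> w = w'.
Proof.
case: w w' => [f f1 f2 f3] [g g1 g2 g3] /= /funext fg; move: f1 f2 f3.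
by rewrite fg => f1 f2 f3; congr Distr; exact: Prop_irrelevance.
Qed.

Lemma distr_ge0 (X : choiceType) (w : distr R X) x : 0 <= w x.
Proof. by case/andP: (distr_itv w x). Qed.

Lemma distr_supp (X : choiceType) (w : distr R X) (x : X) :
  x \notin fset_set [set x | w x != 0] -> w x = 0.
Proof.
rewrite in_fset_set; last exact: distr_finite.
by move=> /negP h; apply/eqP/negPn/negP => wx; apply: h; rewrite inE.
Qed.

Lemma distr_sum_fset (X : choiceType) (w : distr R X) :
  \sum_(x <- fset_set [set x | w x != 0]) w x = 1.
Proof. by rewrite -fsbigTE; [exact: distr_sum | exact: distr_supp]. Qed.

Lemma fsum_eq1_le1 (X : choiceType) (f : X -> R) : (forall x, 0 <= f x) ->
  \sum_(x \in [set: X]) f x = 1 -> forall x, 0 <= f x <= 1.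
Proof.
move=> f0 f1 x; rewrite f0 /=.
have [fin|inf] := pselect (finite_set [set x | f x != 0]); last first.
  move: f1; rewrite fsbig_dflt; first by move/esym/eqP; rewrite oner_eq0.
  apply: contra_not inf; apply: sub_finite_set => y /= /eqP fy.
  by split=> //; exact/eqP.
have [->|fx] := eqVneq (f x) 0; first exact: ler01.
rewrite -f1 (fsbigTE (fset_set [set x | f x != 0])); last first.
  move=> y; rewrite in_fset_set // => /negP h.
  by apply/eqP/negPn/negP => fy; apply: h; rewrite inE.
rewrite (big_fsetD1 x) /=; last by rewrite in_fset_set // inE.
by rewrite lerDl; apply: sumr_ge0.
Qed.

Lemma fsum_fin (T : finType) (f : T -> R) :
  \sum_(x \in [set: T]) f x = \sum_x f x.
Proof.
rewrite [RHS]bigfs ?index_enum_uniq //; last by move=> i _; rewrite mem_index_enum.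
by apply: eq_fsbigl; apply/seteqP; split.
Qed.

Section map.
Variables (X Y : choiceType) (f : X -> Y) (w : distr R X).

Definition dmap_fun (y : Y) : R := \sum_(x \in f @^-1` [set y]) w x.

Lemma dmap_funE y :
  dmap_fun y = \sum_(x <- fset_set [set x | w x != 0] | f x == y) w x.
Proof.
rewrite bigfs ?fset_uniq//; last by move=> i _; exact: distr_supp.
by apply: eq_fsbigl; apply/seteqP; split=> x /= /eqP.
Qed.

Lemma dmap_supp y :
  y \notin (f @` fset_set [set x | w x != 0])%fset -> dmap_fun y = 0.
Proof.
move=> yf; rewrite dmap_funE big_seq_cond big1// => x /andP[xw /eqP fx].
by case/negP: yf; rewrite -fx; apply/imfsetP; exists x.
Qed.

Lemma dmap_finite : finite_set [set y | dmap_fun y != 0].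
Proof.
apply: (finite_subfset (f @` fset_set [set x | w x != 0])%fset) => y /=.
by apply: contra_neqT => /dmap_supp.
Qed.

Lemma dmap_sum : \sum_(y \in [set: Y]) dmap_fun y = 1.
Proof.
rewrite (fsbigTE (f @` fset_set [set x | w x != 0])%fset); last exact: dmap_supp.
under eq_bigr do rewrite dmap_funE.
by rewrite -partition_big_imfset /= distr_sum_fset.
Qed.

Lemma dmap_itv y : 0 <= dmap_fun y <= 1.
Proof.
apply: (fsum_eq1_le1 _ dmap_sum) => {}y.
by rewrite dmap_funE sumr_ge0// => x _; exact: distr_ge0.
Qed.

Definition dmap : distr R Y := Distr dmap_itv dmap_finite dmap_sum.
End map.

Section prod.
Variables (X Y : choiceType) (w : distr R X) (r : distr R Y).

Definition dtensor_fun (p : X * Y) : R := w p.1 * r p.2.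

Lemma dtensor_finite : finite_set [set p | dtensor_fun p != 0].
Proof.
apply: (sub_finite_set _ (finite_setX (distr_finite w) (distr_finite r))).
by move=> p /=; rewrite /dtensor_fun mulf_eq0 negb_or => /andP[].
Qed.

Lemma dtensor_sum : \sum_(p \in [set: (X * Y)%type]) dtensor_fun p = 1.
Proof.
rewrite -(fsbig_widen ([set x | w x != 0] `*` [set y | r y != 0])) //; last first.
  move=> p /= [_] /not_andP /= h; rewrite /dtensor_fun; apply/eqP.
  by rewrite mulf_eq0; case: h => /negP; rewrite negbK => ->; rewrite ?orbT.
have fw := distr_finite w; have fr := distr_finite r.
rewrite -(pair_fsbig _ (fun x y => w x * r y)) //.
under eq_fsbigr do rewrite -mulr_fsumr (fsbig_finite _ _ fr) distr_sum_fset mulr1.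
by rewrite fsbig_finite ?distr_sum_fset.
Qed.

Lemma dtensor_itv p : 0 <= dtensor_fun p <= 1.
Proof.
by apply: (fsum_eq1_le1 _ dtensor_sum) => q; rewrite mulr_ge0 ?distr_ge0.
Qed.

Definition dtensor : distr R (X * Y)%type :=
  Distr dtensor_itv dtensor_finite dtensor_sum.
End prod.

Definition non_entwined (X Y : choiceType) (w : distr R (X * Y)%type) : Prop :=
  w = dtensor (dmap fst w) (dmap snd w).

Section binomial.
Variables (K : nat) (r : R) (r01 : 0 <= r <= 1).

Definition bn_fun (n : 'I_K.+1) : R :=
  'C(K, n)%:R * r ^+ n * (1 - r) ^+ (K - n).

Lemma bn_finite : finite_set [set n | bn_fun n != 0].
Proof. exact: finite_finset. Qed.

Lemma bn_sum : \sum_(n \in [set: 'I_K.+1]) bn_fun n = 1.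
Proof.
rewrite fsum_fin.
rewrite -[RHS](expr1n _ K) -[X in X ^+ K](subrK r 1) exprDn.
by apply: eq_bigr => i _; rewrite /bn_fun -[RHS]mulr_natl -mulrA [r ^+ _ * _]mulrC.
Qed.

Lemma bn_itv n : 0 <= bn_fun n <= 1.
Proof.
apply: (fsum_eq1_le1 _ bn_sum) => {}n; case/andP: r01 => r0 r1.
by rewrite !mulr_ge0 ?exprn_ge0 ?subr_ge0 ?ler0n.
Qed.

Definition bn : distr R 'I_K.+1 := Distr bn_itv bn_finite bn_sum.
End binomial.

End distr_theory.

Arguments bn {R} K r r01.

Definition msize (X : choiceType) (phi : {mset X}%mset) : nat :=
  (\sum_(x <- finsupp phi) phi x)%N.

(* M[K](X); {mset X} is the type of finitely supported functions X -> nat. *)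
Definition msets (K : nat) (X : choiceType) :=
  {phi : {mset X}%mset | msize phi == K}.

Section multinomial.
Variables (R : realType) (K : nat) (X : finType) (w : distr R X).

Lemma msize_fin (phi : {mset X}%mset) : msize phi = (\sum_x phi x)%N.
Proof.
rewrite /msize [RHS](bigID (fun x => x \in finsupp phi)) /=.
rewrite [X in (_ + X)%N]big1 ?addn0; last by move=> x /fsfun_dflt.
rewrite -[RHS]big_filter; apply: perm_big; apply: uniq_perm => //.
- exact: fset_uniq.
- by apply: filter_uniq; exact: index_enum_uniq.
- by move=> x; rewrite mem_filter mem_index_enum andbT.
Qed.

Lemma sum_tuple_cons n (P : pred (n.+1.-tuple X)) (F : n.+1.-tuple X -> R) :
  \sum_(t | P t) F t =
  \sum_x \sum_(t : n.-tuple X | P [tuple of x :: t]) F [tuple of x :: t].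
Proof.
rewrite pair_big_dep /=.
rewrite (reindex (fun p : X * n.-tuple X => [tuple of p.1 :: p.2])) //=.
exists (fun t : n.+1.-tuple X => (thead t, [tuple of behead t])).
  by move=> [x t] _ /=; rewrite theadE; congr pair; exact: val_inj.
by move=> t _ /=; rewrite -tuple_eta.
Qed.

Lemma sum_tuple_prod n : \sum_(t : n.-tuple X) \prod_(x <- t) w x = 1.
Proof.
elim: n => [|n IH].
  rewrite (big_pred1 [tuple]) ?big_nil // => t.
  by apply/esym/eqP; exact: tuple0.
rewrite sum_tuple_cons -[RHS](distr_sum w) fsum_fin; apply: eq_bigr => x _.
by under eq_bigr do rewrite big_cons; rewrite -mulr_sumr IH mulr1.
Qed.

Definition mn_fun (phi : msets K X) : R :=
  K`!%:R / (\prod_x (val phi x)`!)%:R * \prod_x w x ^+ val phi x.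

Lemma mn_funE (phi : msets K X) :
  mn_fun phi = \sum_(t : K.-tuple X | seq_mset t == val phi) \prod_(x <- t) w x.
Proof.
rewrite /mn_fun; move: (val phi) (eqP (valP phi)) => {}phi; rewrite msize_fin.
elim: K phi => [|n IH] phi sz.
  have z x : phi x = 0%N.
    by apply/eqP; move/eqP: sz; rewrite sum_nat_eq0 => /forallP /(_ x).
  have e0 : seq_mset (@nil X) = phi.
    by apply/fsfunP => x; rewrite mset_seqE z.
  under eq_bigr do rewrite z.
  under [X in _ * X]eq_bigr do rewrite z expr0.
  rewrite big1 // big1 // fact0 mulr1n divr1 mul1r (big_pred1 [tuple]) ?big_nil // => t.
  by rewrite !tuple0 /= e0 !eqxx.
pose T x := \sum_(t : n.-tuple X | seq_mset (x :: t) == phi) \prod_(y <- t) w y.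
transitivity (\sum_x w x * T x); last first.
  rewrite sum_tuple_cons; apply: eq_bigr => x _; rewrite mulr_sumr.
  by apply: eq_bigr => t _; rewrite big_cons.
pose C : R := n`!%:R / (\prod_x (phi x)`!)%:R * \prod_x w x ^+ phi x.
transitivity (\sum_x (phi x)%:R * C).
  by rewrite -mulr_suml -natr_sum sz factS natrM /C !mulrA.
apply: eq_bigr => x _; have [px|px] := posnP (phi x).
  rewrite px mul0r /T big1 ?mulr0 // => t /eqP e.
  by move: px; rewrite -e mset_seqE /= eqxx.
pose psi := msetB phi (msetn 1 x).
have psiE y : psi y = (phi y - (y == x))%N by rewrite msetB1E.
have Tpsi : T x = \sum_(t : n.-tuple X | seq_mset t == psi) \prod_(y <- t) w y.
  apply: eq_bigl => t; apply/eqP/eqP => [e|e]; apply/fsfunP => y.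
    by rewrite psiE -e !mset_seqE /= eq_sym addKn.
  rewrite mset_seqE /= -mset_seqE e psiE eq_sym.
  by have [->|_] := eqVneq y x; rewrite ?subnKC // subn0.
have psix : psi x = (phi x).-1 by rewrite psiE eqxx subn1.
have psiy y : y != x -> psi y = phi y.
  by move=> yx; rewrite psiE (negbTE yx) subn0.
rewrite Tpsi -IH; last first.
  apply/eqP; rewrite -eqSS -sz; apply/eqP.
  rewrite (bigD1 x) //= [RHS](bigD1 x) //= psix -addSn prednK //.
  by congr addn; apply: eq_bigr => y; exact: psiy.
pose N := (\prod_(y | y != x) (phi y)`!)%N.
pose W := \prod_(y | y != x) w y ^+ phi y.
have Nphi : (\prod_y (phi y)`! = (phi x)`! * N)%N by rewrite (bigD1 x).
have Npsi : (\prod_y (psi y)`! = (phi x).-1`! * N)%N.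
  by rewrite (bigD1 x) //= psix; congr muln; apply: eq_bigr => y /psiy ->.
have Wphi : \prod_y w y ^+ phi y = w x ^+ phi x * W by rewrite (bigD1 x).
have Wpsi : \prod_y w y ^+ psi y = w x ^+ (phi x).-1 * W.
  by rewrite (bigD1 x) //= psix; congr (_ * _); apply: eq_bigr => y /psiy ->.
rewrite /C Nphi Npsi Wphi Wpsi; case: (phi x) px => // k _.
rewrite factS exprS /= !natrM.
have nz : N%:R != 0 :> R.
  by rewrite pnatr_eq0 -lt0n prodn_gt0 // => y; exact: fact_gt0.
have kn : k`!%:R != 0 :> R by rewrite pnatr_eq0 -lt0n fact_gt0.
have k1 : 1 + k%:R != 0 :> R by rewrite nat1r pnatr_eq0.
by field; rewrite k1 nz kn.
Qed.

Lemma tuple_msetsP (t : K.-tuple X) : msize (seq_mset t) == K.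
Proof.
rewrite msize_fin; under eq_bigr do rewrite mset_seqE.
under eq_bigr do rewrite -sum1_count big_mkcond.
rewrite exchange_big /= -[X in _ == X](size_tuple t) -sum1_size; apply/eqP.
apply: eq_bigr => y _; rewrite (bigD1 y) //= eqxx big1 ?addn0 // => x /negbTE.
by rewrite eq_sym => ->.
Qed.

Definition tuple_msets (t : K.-tuple X) : msets K X :=
  exist _ (seq_mset t) (tuple_msetsP t).

Lemma tuple_msetsE t phi : (tuple_msets t == phi) = (seq_mset t == val phi).
Proof. by rewrite -val_eqE. Qed.

Let supp := [fset tuple_msets t | t in index_enum (K.-tuple X)]%fset.

Lemma mn_supp phi : phi \notin supp -> mn_fun phi = 0.
Proof.
move=> phiN; rewrite mn_funE big1 // => t; rewrite -tuple_msetsE => /eqP e.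
by case/negP: phiN; rewrite -e; apply/imfsetP; exists t => //=; rewrite mem_index_enum.
Qed.

Lemma mn_finite : finite_set [set phi | mn_fun phi != 0].
Proof.
by apply: (finite_subfset supp) => phi /=; apply: contra_neqT => /mn_supp.
Qed.

Lemma mn_sum : \sum_(phi \in [set: msets K X]) mn_fun phi = 1.
Proof.
rewrite (fsbigTE supp); last exact: mn_supp.
under eq_bigr do rewrite mn_funE.
under eq_bigr do under eq_bigl do rewrite -tuple_msetsE.
rewrite (exchange_big_dep xpredT) //= -[RHS](sum_tuple_prod K).
apply: eq_bigr => t _; rewrite [LHS]big_mkcond (bigD1_seq (tuple_msets t)) /= ?fset_uniq //.
  by rewrite eqxx [X in _ + X]big1 ?addr0 // => phi /negbTE; rewrite eq_sym => ->.
by apply/imfsetP; exists t => //=; rewrite mem_index_enum.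
Qed.

Lemma mn_itv phi : 0 <= mn_fun phi <= 1.
Proof.
apply: (fsum_eq1_le1 _ mn_sum) => {}phi; rewrite mn_funE.
by apply: sumr_ge0 => t _; apply: prodr_ge0 => x _; exact: distr_ge0.
Qed.

Definition mn : distr R (msets K X) := Distr mn_itv mn_finite mn_sum.
End multinomial.

(* The set 2 = {0, 1} is bool, with 1 = true (heads), and {0, ..., K} is 'I_K.+1. *)
Section bivariate.
Variable K : nat.
Implicit Type phi : msets K (bool * bool)%type.

Let msets2_size phi :
  (val phi (true, true) + val phi (true, false) +
   (val phi (false, true) + val phi (false, false)) = K)%N.
Proof.
move: (eqP (valP phi)); rewrite msize_fin.
rewrite (eq_bigr (fun p => val phi (p.1, p.2))); last by case.
by rewrite -(pair_bigA _ (fun i j => val phi (i, j))) /= !big_bool.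
Qed.

Let heads1_subproof phi :
  (val phi (true, false) + val phi (true, true) < K.+1)%N.
Proof. by rewrite ltnS -[leqRHS](msets2_size phi) [leqLHS]addnC leq_addr. Qed.

Let heads2_subproof phi :
  (val phi (false, true) + val phi (true, true) < K.+1)%N.
Proof.
rewrite ltnS -[leqRHS](msets2_size phi) addnACA [leqLHS]addnC.
exact: leq_addr.
Qed.

Definition heads phi : 'I_K.+1 * 'I_K.+1 :=
  (Ordinal (heads1_subproof phi), Ordinal (heads2_subproof phi)).

Definition bvbn (R : realType) (gamma : distr R (bool * bool)%type) :
    distr R ('I_K.+1 * 'I_K.+1)%type :=
  dmap heads (mn K gamma).
End bivariate.

(* Main.v *)
Require Import Defs.
From mathcomp Require Import all_boot all_order all_algebra reals.
From mathcomp Require Import finmap multiset boolp classical_sets.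
From mathcomp Require Import cardinality fsbigop zify ring.

(** Everything is read off from the i.i.d. distribution [iid K w] of the
    [K]-tuples of independent draws from [w].  The multinomial is its image
    under forgetting the order of the draws ([dmap_iid_mset]), and the binomial
    is its image, for a coin [w], under counting heads ([dmap_iid_ntrue]).  As
    marginal heads are already visible on tuples ([heads_tuple_msets]), the
    bivariate binomial of [gamma] is the image of [iid K gamma] under
    [t |-> (ntrue (map fst t), ntrue (map snd t))] ([bvbnE]).

    Both claims then come from the way [iid K] behaves.  It is natural: mapping
    every draw along [f] gives i.i.d. draws from the image of [w]
    ([dmap_iid_map]), so that a marginal of the bivariate binomial counts heads
    in independent tosses of a coin with law the marginal of [gamma].  It is
    monoidal: a tuple of independent draws from [w] and [r] in parallel is the
    zip of two independent tuples ([iid_dtensor]), so that in the non-entwined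
    case the two counts of heads are computed from independent tuples. *)

Set Implicit Arguments.
Unset Strict Implicit.
Unset Printing Implicit Defensive.

Import GRing.Theory Num.Theory.

Local Open Scope ring_scope.

Section images.
Variable R : realType.

Lemma dmap_finE (X : finType) (Y : choiceType) (f : X -> Y) (w : distr R X) y :
  dmap f w y = \sum_(x | f x == y) w x.
Proof.
rewrite /= /dmap_fun [RHS]bigfs ?index_enum_uniq//; last first.
  by move=> x _; rewrite mem_index_enum.
by apply: eq_fsbigl; apply/seteqP; split=> x /= /eqP.
Qed.

Lemma dmap_comp (X Y Z : choiceType) (g : Y -> Z) (f : X -> Y) (w : distr R X) :
  dmap g (dmap f w) = dmap (g \o f) w.
Proof.
apply: distr_ext => z; rewrite [RHS]dmap_funE.
set S := fset_set [set x | w x != 0].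
(* No point outside the image of the support of [w] has mass under [dmap f w]. *)
transitivity (\sum_(y <- (f @` S)%fset | g y == z) dmap f w y).
  rewrite bigfs ?fset_uniq//; last by move=> y _; exact: dmap_supp.
  by apply: eq_fsbigl; apply/seteqP; split=> y /= /eqP.
under eq_bigr do rewrite /= dmap_funE.
rewrite (exchange_big_dep (fun x => g (f x) == z)) /=; last first.
  by move=> y x /eqP <- /eqP ->.
rewrite big_seq_cond [RHS]big_seq_cond; apply: eq_bigr => x /andP[xS gfx].
rewrite [LHS]big_mkcond (bigD1_seq (f x)) ?fset_uniq ?in_imfset //= gfx eqxx.
rewrite [X in _ + X]big1 ?addr0// => y /negbTE.
by rewrite eq_sym => ->; rewrite andbF.
Qed.

Lemma dmap_dtensor (X Y : finType) (X' Y' : choiceType) (f : X -> X')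
    (g : Y -> Y') (w : distr R X) (r : distr R Y) :
  dmap (fun p => (f p.1, g p.2)) (dtensor w r) = dtensor (dmap f w) (dmap g r).
Proof.
apply: distr_ext => -[x' y'].
rewrite dmap_finE [RHS]/= /dtensor_fun !dmap_finE /= big_distrlr /= pair_big /=.
by apply: eq_big => p //; rewrite xpair_eqE.
Qed.

End images.

Section iid.
Variables (R : realType) (X : finType).

Definition iid_fun K (w : distr R X) (t : K.-tuple X) : R := \prod_(x <- t) w x.

Lemma iid_finite K (w : distr R X) : finite_set [set t | iid_fun (K := K) w t != 0].
Proof. exact: finite_finset. Qed.

Lemma iid_sum K (w : distr R X) :
  \sum_(t \in [set: K.-tuple X]) iid_fun w t = 1.
Proof. by rewrite fsum_fin; exact: sum_tuple_prod. Qed.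

Lemma iid_itv K (w : distr R X) (t : K.-tuple X) : 0 <= iid_fun w t <= 1.
Proof.
apply: (fsum_eq1_le1 _ (iid_sum K w)) => {}t.
by apply: prodr_ge0 => x _; exact: distr_ge0.
Qed.

Definition iid K (w : distr R X) : distr R (K.-tuple X) :=
  Distr (iid_itv w) (iid_finite K w) (iid_sum K w).

Lemma iid_cons K (w : distr R X) x (t : K.-tuple X) :
  iid K.+1 w [tuple of x :: t] = w x * iid K w t.
Proof. by rewrite /= /iid_fun /= big_cons. Qed.

Lemma dmap_iid_mset K (w : distr R X) :
  dmap (@tuple_msets K X) (iid K w) = mn K w.
Proof.
apply: distr_ext => phi; rewrite dmap_finE [RHS]mn_funE.
by apply: eq_bigl => t; rewrite tuple_msetsE.
Qed.

End iid.

(** The preimages of a tuple [s] are chosen entry by entry, so that their sum of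
    products of masses factors into the masses of the entries of [s] under
    [dmap f w]. *)
Lemma dmap_iid_map (R : realType) (X Y : finType) (f : X -> Y) K
    (w : distr R X) :
  dmap (map_tuple f) (iid K w) = iid K (dmap f w).
Proof.
apply: distr_ext => s; rewrite dmap_finE.
elim: K s => [|K IH] s.
  rewrite (tuple0 s) (big_pred1 [tuple]) /= /iid_fun ?big_nil // => t.
  by rewrite (tuple0 t) [RHS]eqxx; apply/eqP; exact: tuple0.
case/tupleP: s => y s; rewrite iid_cons -IH dmap_finE big_distrlr /=.
rewrite sum_tuple_cons [RHS]big_mkcond; apply: eq_bigr => x _.
case: ifPn => fx.
  apply: eq_big => [t|t _]; last exact: iid_cons.
  by rewrite -val_eqE /= eqseq_cons fx.
by apply: big_pred0 => t; rewrite -val_eqE /= eqseq_cons (negbTE fx).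
Qed.

(** A tuple of pairs is the zip of exactly one pair of tuples, and the product
    of the masses of its entries splits accordingly. *)
Lemma iid_dtensor (R : realType) (X Y : finType) K (w : distr R X)
    (r : distr R Y) :
  iid K (dtensor w r) =
  dmap (fun p : K.-tuple X * K.-tuple Y => [tuple of zip p.1 p.2])
       (dtensor (iid K w) (iid K r)).
Proof.
apply: distr_ext => t; rewrite dmap_finE.
rewrite (big_pred1 (map_tuple fst t, map_tuple snd t)); last first.
  move=> [a b]; rewrite /= xpair_eqE -!val_eqE /=.
  apply/eqP/andP => [<-|[/eqP -> /eqP ->]]; last exact: zip_unzip.
  by rewrite -/unzip1 -/unzip2 unzip1_zip ?unzip2_zip ?size_tuple.
by rewrite /= /dtensor_fun /= /iid_fun !big_map -big_split.
Qed.

Section ntrue.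
Variable K : nat.

Lemma count_tuple_ltS (t : K.-tuple bool) : (count id t < K.+1)%N.
Proof. by rewrite ltnS -[leqRHS](size_tuple t) count_size. Qed.

Definition ntrue (t : K.-tuple bool) : 'I_K.+1 := Ordinal (count_tuple_ltS t).

End ntrue.

Lemma distr_bool_false (R : realType) (w : distr R bool) :
  w false = 1 - w true.
Proof. by rewrite -(distr_sum w) fsum_fin big_bool addrAC subrr add0r. Qed.

(** Splitting on the first toss is Pascal's rule.  The count [n] ranges over
    all of [nat], the binomial coefficient being zero when [n > K], so that the
    induction on [K] does not leave the range of validity. *)
Lemma sum_iid_count (R : realType) (w : distr R bool) K n :
  \sum_(t : K.-tuple bool | count id t == n) iid K w t =
  'C(K, n)%:R * w true ^+ n * (1 - w true) ^+ (K - n).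
Proof.
elim: K n => [|K IH] n.
  rewrite bin0n sub0n expr0 mulr1; case: n => [|n] /=.
    rewrite (big_pred1 [tuple]) /= /iid_fun ?big_nil ?mulr1 // => t.
    by rewrite !tuple0 [RHS]eqxx.
  by rewrite mul0r big_pred0// => t; rewrite tuple0.
rewrite sum_tuple_cons big_bool.
under eq_bigr do rewrite iid_cons.
under [X in _ + X = _]eq_bigr do rewrite iid_cons.
rewrite -!mulr_sumr /= IH distr_bool_false.
case: n => [|n]; first by
  rewrite big_pred0// mulr0 add0r !bin0 !subn0 !expr0 !mul1r exprS.
rewrite (eq_bigl (fun t : K.-tuple bool => count id t == n))//.
rewrite IH binS natrD subSS.
have [Kn|nK] := leqP K n.
  by rewrite (@bin_small K n.+1)// exprS; ring.
by rewrite -(subnSK nK) !exprS; ring.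
Qed.

Lemma dmap_iid_ntrue (R : realType) K (w : distr R bool) :
  dmap (@ntrue K) (iid K w) = bn K (w true) (distr_itv w true).
Proof.
by apply: distr_ext => n; rewrite dmap_finE [RHS]/= /bn_fun -sum_iid_count.
Qed.

Lemma heads_tuple_msets K (t : K.-tuple (bool * bool)) :
  heads (tuple_msets t) = (ntrue (map_tuple fst t), ntrue (map_tuple snd t)).
Proof.
congr pair; apply: val_inj; rewrite /= !mset_seqE count_map.
  by elim: (val t) => //= -[[] []] s /=; lia.
by elim: (val t) => //= -[[] []] s /=; lia.
Qed.

Lemma bvbnE (R : realType) K (gamma : distr R (bool * bool)%type) :
  bvbn K gamma =
  dmap (fun t => (ntrue (map_tuple fst t), ntrue (map_tuple snd t)))
       (iid K gamma).
Proof.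
rewrite /bvbn -dmap_iid_mset dmap_comp; congr (dmap _ _).
by apply: funext => t; exact: heads_tuple_msets.
Qed.

Lemma dmap_fst_bvbn (R : realType) K (gamma : distr R (bool * bool)%type) :
  dmap fst (bvbn K gamma) =
  bn K (dmap fst gamma true) (distr_itv (dmap fst gamma) true).
Proof. by rewrite bvbnE -dmap_iid_ntrue -dmap_iid_map !dmap_comp. Qed.

Lemma dmap_snd_bvbn (R : realType) K (gamma : distr R (bool * bool)%type) :
  dmap snd (bvbn K gamma) =
  bn K (dmap snd gamma true) (distr_itv (dmap snd gamma) true).
Proof. by rewrite bvbnE -dmap_iid_ntrue -dmap_iid_map !dmap_comp. Qed.

Lemma bvbn_dtensor (R : realType) K (w r : distr R bool) :
  bvbn K (dtensor w r) =
  dtensor (bn K (w true) (distr_itv w true)) (bn K (r true) (distr_itv r true)).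
Proof.
rewrite bvbnE iid_dtensor dmap_comp -!dmap_iid_ntrue -dmap_dtensor.
congr (dmap _ _); apply: funext => -[a b] /=.
by congr pair; apply: val_inj;
  rewrite /= -/unzip1 -/unzip2 ?unzip1_zip ?unzip2_zip ?size_tuple.
Qed.

Theorem lemma3p6 (R : realType) (K : nat) (gamma : distr R (bool * bool)%type) :
  let gamma1 : distr R bool := dmap fst gamma in
  let gamma2 : distr R bool := dmap snd gamma in
  let bn1 := bn K (gamma1 true) (distr_itv gamma1 true) in
  let bn2 := bn K (gamma2 true) (distr_itv gamma2 true) in
  (dmap fst (bvbn K gamma) = bn1 /\ dmap snd (bvbn K gamma) = bn2)
  /\
  (non_entwined gamma ->
     non_entwined (bvbn K gamma) /\
     bvbn K (dtensor gamma1 gamma2) = dtensor bn1 bn2).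
Proof.
move=> gamma1 gamma2 bn1 bn2.
split; first by split; [exact: dmap_fst_bvbn | exact: dmap_snd_bvbn].
move=> ne; have bvbn12 := bvbn_dtensor K gamma1 gamma2; split=> //.
by rewrite /non_entwined dmap_fst_bvbn dmap_snd_bvbn -bvbn12 -ne.
Qed.
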